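(* For every non-negative integer $M$, $$\sum_{m,n\geq 0} \frac{q^{Q(m,n)-2m-3n}(q^3;q^3)_M}{(q;q)_m (q^3;q^3)_n(q^3;q^3)_{M-2n-m}}(1+q^{3M}) = \sum_{j=-M}^M q^{3j^2-2j}(1+q^{3j}) {2M\brack M+j}_{q^3},$$ where $Q(m,n)=2m^2+6mn+6n^2$.
   Context: $(a;p)_n=\prod_{i=0}^{n-1}(1-ap^i)$ for $n\ge 0$; $1/(p;p)_k=0$ for negative $k$. ${m+n\brack m}_p=\frac{(p;p)_{m+n}}{(p;p)_m(p;p)_n}$ for $m,n\ge0$ and $0$ otherwise. *)

(* Defs.v *)
From mathcomp Require Import all_boot all_order all_algebra.
From mathcomp Require Import classical_sets fsbigop.

Set Implicit Arguments.
Unset Strict Implicit.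
Unset Printing Implicit Defensive.

Import GRing.Theory.
Local Open Scope ring_scope.

Section QSeries.
Variable F : fieldType.
Implicit Types (a p : F).

Definition qpoch a p (n : nat) : F := \prod_(i < n) (1 - a * p ^+ i).

(* 1 / (p; p)_k, extended by 0 to negative k *)
Definition qpochV p (k : int) : F :=
  if k is Posz n then (qpoch p p n)^-1 else 0.

(* [N brack m]_p, i.e. [m + n brack m]_p for n = N - m, and 0 unless
   m and N - m are both nonnegative *)
Definition qbinom p (N m : int) : F :=
  match m, N - m with
  | Posz m', Posz n' => qpoch p p (m' + n') / (qpoch p p m' * qpoch p p n')
  | _, _ => 0
  end.

End QSeries.

Definition Qform (m n : int) : int := 2 * m ^+ 2 + 6 * m * n + 6 * n ^+ 2.

(* Main.v *)
Require Import Defs.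
From mathcomp Require Import all_boot all_order all_algebra.
From mathcomp Require Import classical_sets fsbigop.
From mathcomp Require Import zify ring.

(* Write p = q^3 and N = p^M.  Grouping the left-hand side by r = m + 2n, the
   exponent splits as C(m,2) + 3 C(r,2), so its inner sum over m + 2n = r has the
   generating function g(t) = (-t; q)_oo / (t^2; p)_oo, for which
     (1 - t) (1 - p t^2) g(t) = (1 + q t) (1 + q^2 t) g(p t).
   The weights p^C(r,2) and 1 / (p; p)_(M-r) turn this into a recurrence of order 2
   in M for the double sum L_M.
   On the other side, the moments mu_k = sum_j q^(3j^2+kj) [2M; M+j]_p satisfy
   p q^k mu_(k+6) + N (1 - p q^k) mu_(k+3) = mu_k and mu_(-k) = mu_k, so those with
   3 not dividing k lie in the span of A_M = mu_1 and B_M = mu_2.  This gives a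
   first-order linear system for (A_M, B_M), which yields
     A_(M+1) + B_(M+1) = (1 + p N) ((1 + q N) A_M + (1 + q^2 N) B_M),
   and by induction (1 + N) L_M = A_M + B_M together with
   L_(M+1) = (1 + q N) A_M + (1 + q^2 N) B_M. *)

Set Implicit Arguments.
Unset Strict Implicit.
Unset Printing Implicit Defensive.

Import GRing.Theory.
Local Open Scope classical_set_scope.
Local Open Scope ring_scope.

Lemma exprzX (R : unitRingType) (x : R) (n : nat) (k : int) : (x ^+ n) ^ k = (x ^ k) ^+ n.
Proof. by rewrite !exprnP !exprz_exp mulrC. Qed.

(** * Reciprocals of q-Pochhammer symbols at integer indices *)

Section QPochhammer.
Variables (F : fieldType) (p : F).
Hypothesis p_nroot : forall k : nat, (0 < k)%N -> p ^+ k != 1.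

Lemma qpochS n : qpoch p p n.+1 = qpoch p p n * (1 - p ^+ n.+1).
Proof. by rewrite /qpoch big_ord_recr /= exprS. Qed.

Lemma qpochV_neg k : k < 0 -> qpochV p k = 0.
Proof. by case: k. Qed.

Lemma qpochV0 : qpochV p 0 = 1.
Proof. by rewrite /= /qpoch big_ord0 invr1. Qed.

(** At k = 0 the factor 1 - p^k vanishes, in agreement with 1/(p;p)_(-1) = 0, so the recursion holds
    at every integer. *)
Lemma qpochV_pred k : (1 - p ^ k) * qpochV p k = qpochV p (k - 1).
Proof.
case: k => [[|n]|n]; last by rewrite mulr0.
  by rewrite expr0z subrr mul0r.
rewrite (_ : n.+1%:Z - 1 = n); last by lia.
rewrite /= -exprnP qpochS invfM mulrCA divff ?mulr1 //.
by rewrite subr_eq0 eq_sym p_nroot.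
Qed.

Lemma qbinomE (N : nat) (m : int) :
  qbinom p N m = qpoch p p N * (qpochV p m * qpochV p (N%:Z - m)).
Proof.
rewrite /qbinom; case: m => [m|m]; last by rewrite mul0r mulr0.
case E: (N%:Z - m%:Z) => [n|n] /=; last by rewrite !mulr0.
by rewrite (_ : (m + n)%N = N) ?invfM //; lia.
Qed.

End QPochhammer.

(** * Sums over a symmetric window of integers *)

Section ZSum.
Variables (V : zmodType) (K : nat).

(** The window [-K, K] is independent of M, so that moments for different M are sums over the same
    range. *)
Definition zsum (f : int -> V) : V := \sum_(i < K.*2.+1) f (i%:Z - K%:Z).

Lemma zsum_telescope f : zsum (fun j => f (j + 1) - f j) = f (K%:Z + 1) - f (- K%:Z).
Proof.
rewrite /zsum -(big_mkord xpredT (fun i : nat => f (i%:Z - K%:Z + 1) - f (i%:Z - K%:Z))).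
rewrite (eq_bigr (fun i : nat => f (i.+1%:Z - K%:Z) - f (i%:Z - K%:Z))).
  rewrite (@telescope_sumr _ 0 K.*2.+1 (fun i => f (i%:Z - K%:Z))) // sub0r.
  by congr (f _ - _); lia.
by move=> i _; congr (f _ - _); lia.
Qed.

Lemma zsum_opp f : zsum (fun j => f (- j)) = zsum f.
Proof.
rewrite /zsum (reindex_inj rev_ord_inj); apply: eq_bigr => i _.
by congr f; have := ltn_ord i; rewrite /=; lia.
Qed.

Lemma eq_zsum f g : f =1 g -> zsum f = zsum g.
Proof. by move=> fg; apply: eq_bigr => i _. Qed.

Lemma zsum_fsbig (A : set int) (f : int -> V) :
    (forall j, A j -> - K%:Z <= j <= K%:Z) -> (forall j, ~ A j -> f j = 0) ->
  \sum_(j \in A) f j = zsum f.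
Proof.
move=> AK f0; rewrite /zsum -(big_mkord xpredT (fun i : nat => f (i%:Z - K%:Z))).
rewrite -(big_map (fun i : nat => i%:Z - K%:Z) xpredT f).
apply: fsbig_fwiden.
- move=> + /AK /andP[]; change (forall j : int, - K%:Z <= j -> j <= K%:Z ->
    j \in map (fun i : nat => i%:Z - K%:Z) (index_iota 0 K.*2.+1)).
  move=> j j1 j2; apply/mapP; exists (absz (j + K%:Z)).
    by rewrite mem_index_iota; lia.
  by lia.
- by rewrite map_inj_uniq ?iota_uniq // => i j; lia.
- by move=> j [_ /f0].
Qed.

End ZSum.

(** * Moments of the right-hand sum and their recurrences *)

Section Moments.
Variables (F : fieldType) (q : F).
Hypothesis q_neq0 : q != 0.
Hypothesis q_nroot : forall k : nat, (0 < k)%N -> q ^+ k != 1.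
Local Notation p := (q ^+ 3).
Local Notation V := (qpochV p).

Let p_neq0 : p != 0. Proof. exact: expf_neq0. Qed.
Let p_nroot k : (0 < k)%N -> p ^+ k != 1.
Proof. by move=> k0; rewrite -exprM q_nroot // muln_gt0. Qed.

Variable K : nat.

(* moment_term carries 1 / ((p; p)_(M-j) (p; p)_(M+j)); the factor (p; p)_(2M) of the
   binomial only enters in rhs_poly. *)
Definition moment_term (k : int) (M : int) (j : int) : F :=
  q ^ (3 * j ^+ 2) * (q ^ j) ^ k * (V (M - j) * V (M + j)).

Definition moment (k : int) (M : int) : F := zsum K (moment_term k M).

Lemma momentN k M : moment (- k) M = moment k M.
Proof.
rewrite /moment -zsum_opp; apply: eq_zsum => j; rewrite /moment_term.
by rewrite sqrrN !exprz_exp mulrNN opprK (mulrC (V (M + j))).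
Qed.

(** Telescoping: by [qpochV_pred], G(j+1) - G(j) is the summand of the left-hand side. *)
Lemma moment_rel k (M : int) : M <= K%:Z ->
  p * q ^ k * moment (k + 6) M + p ^ M * (1 - p * q ^ k) * moment (k + 3) M
    - moment k M = 0.
Proof.
move=> MK.
pose G j := q ^ (3 * j ^+ 2) * (q ^ j) ^ k * (V (M - j) * V (M + j - 1)).
have: zsum K (fun j => G (j + 1) - G j) = 0.
  (* Both boundary values contain 1/(p;p)_(M-K-1), which is 0 because M <= K. *)
  rewrite zsum_telescope /G [V (M - (_ + 1))]qpochV_neg; last by lia.
  rewrite [V (M + - _ - 1)]qpochV_neg; last by lia.
  by rewrite mul0r !mulr0 subrr.
move=> <-; rewrite /moment /zsum !mulr_sumr -sumrN -!big_split.
apply: eq_bigr => i _ /=; move: (_ - K%:Z) => j; rewrite /moment_term /G.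
rewrite (_ : M - (j + 1) = M - j - 1); last by lia.
rewrite (_ : M + (j + 1) - 1 = M + j); last by lia.
rewrite -!qpochV_pred // (_ : 3 * (j + 1) ^+ 2 = 3 * j ^+ 2 + (j * 6%:Z + 3%:Z)); last by lia.
rewrite !expfzDr ?expfz_neq0 // !(expfzMl (q ^ j)) expr1z.
rewrite -(exprz_exp q j 6) -!exprnP.
rewrite (exprzX q 3 (- j)) -invr_expz.
rewrite (exprzX q 3 j).
have : q ^ j != 0 by rewrite expfz_neq0.
move: (V _) (V _) (q ^ j) (q ^ k) (p ^ M) => v w y qk N y0.
by field.
Qed.

(** Lowering M multiplies the summand by (1 - N q^(-3j)) (1 - N q^(3j)), where N = p^M; expanding
    this shifts k by 3 and -3. *)
Lemma moment_pred k (M : int) :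
  moment k (M - 1) = (1 + (p ^ M) ^+ 2) * moment k M
     - p ^ M * (moment (k + 3) M + moment (k - 3) M).
Proof.
rewrite /moment /zsum mulrDr !mulr_sumr -big_split /= -sumrN -!big_split.
apply: eq_bigr => i _ /=; move: (_ - K%:Z) => j; rewrite /moment_term.
rewrite (_ : M - 1 - j = M - j - 1); last by lia.
rewrite (_ : M - 1 + j = M + j - 1); last by lia.
rewrite -!qpochV_pred // !expfzDr ?expfz_neq0 //.
rewrite (exprzX q 3 (- j)) -invr_expz.
rewrite (exprzX q 3 j).
rewrite -(invr_expz _ 3) -!exprnP.
have : q ^ j != 0 by rewrite expfz_neq0.
move: (V _) (V _) (q ^ j) (p ^ M) => v w y N y0.
by field.
Qed.

Lemma moment0 k : moment k 0 = 1.
Proof.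
rewrite /moment /zsum.
have K2 : (K < K.*2.+1)%N by lia.
rewrite (bigD1 (Ordinal K2)) //= subrr big1 ?addr0.
  by rewrite /moment_term (exp1rz _ k : (q ^ 0) ^ k = 1) subr0 !mulr1 qpochV0 !mulr1 expr0n mulr0 expr0z.
move=> i /eqP iK; rewrite /moment_term.
have [ltK|geK] := ltnP i K.
  by rewrite [V (0 + (_ + _))]qpochV_neg ?mulr0 ?mulr0 //; lia.
rewrite [V (0 - _)]qpochV_neg ?mul0r ?mulr0 //.
by have : (i <> K :> nat) by [move=> E; apply: iK; apply: val_inj]; lia.
Qed.

Definition rhs_poly (k : int) (M : nat) : F := qpoch p p M.*2 * moment k M.

(** Eliminating mu_4 and mu_5 by [moment_rel], [moment_pred] gives (mu_1, mu_2) at M as a 2x2 matrix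
    times (mu_1, mu_2) at M+1. With N = p^(M+1) its determinant is (1 - N^2) (1 - N^2/p) =
    (p;p)_(2M+2) / (p;p)_(2M), so after normalisation the inverse system is given by the
    adjugate. *)
Lemma rhs_polyS M : (M < K)%N ->
  rhs_poly 1 M.+1 = (1 + p ^+ M.+1 ^+ 2 / q ^+ 2) * rhs_poly 1 M
                + p ^+ M.+1 * (1 + q^-1) * rhs_poly 2 M
  /\ rhs_poly 2 M.+1 = (1 + p ^+ M.+1 ^+ 2 / q) * rhs_poly 2 M
                + p ^+ M.+1 * (1 + q ^- 2) * rhs_poly 1 M.
Proof.
move=> MK; rewrite /rhs_poly doubleS !qpochS.
have r1 := @moment_rel (-2) M.+1 MK; have r2 := @moment_rel (-1) M.+1 MK.
have s1 := moment_pred 1 M.+1; have s2 := moment_pred 2 M.+1.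
move: r1 r2 s1 s2; rewrite -!exprnP (_ : -2 + 6 = 4) // (_ : -2 + 3 = 1) //.
rewrite (_ : -1 + 6 = 5) // (_ : -1 + 3 = 2) // (_ : 1 + 3 = 4) // (_ : 1 - 3 = - 2) //.
rewrite (_ : 2 + 3 = 5) // (_ : 2 - 3 = - 1) // !momentN (_ : M.+1%:Z - 1 = M); last by lia.
rewrite -!invr_expz -!exprnP expr1.
rewrite (_ : p ^+ M.*2.+2 = p ^+ M.+1 ^+ 2); last by rewrite -(exprM p) muln2.
rewrite (_ : p ^+ M.*2.+1 = p ^+ M.+1 ^+ 2 / p); last first.
  by rewrite -(exprM p) muln2 doubleS (exprSr _ M.*2.+1) mulfK.
move: (moment 4 _) (moment 1 M.+1) (moment 2 M.+1) (moment 5 _) (moment 1 M) (moment 2 M).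
move: (p ^+ M.+1) (qpoch _ _ _) => N P m4 m1 m2 m5 a b r1 r2 sa sb.
have e4 : m4 = (m2 - N * (1 - q) * m1) / q.
  by apply: (mulfI q_neq0); move/eqP: r1; rewrite subr_eq0 => /eqP <-; field.
have e5 : m5 = (m1 - N * (1 - q ^+ 2) * m2) / q ^+ 2.
  have q2 : q ^+ 2 != 0 by rewrite expf_neq0.
  by apply: (mulfI q2); move/eqP: r2; rewrite subr_eq0 => /eqP <-; field.
by rewrite sa sb e4 e5; split; field.
Qed.

End Moments.

(** * Truncated convolution with the coefficients of 1/(p^b t^d; p)_oo *)

Section Convolution.
Variables (F : fieldType) (p : F) (B : nat).
Hypothesis p_nroot : forall k : nat, (0 < k)%N -> p ^+ k != 1.

(** By Euler's expansion of 1/(x; p)_oo, this is the coefficient of t^r in U(t) / (p^b t^d; p)_oo,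
    where U has coefficients [u], cut at n < B. *)
Definition conv (d b : nat) (u : int -> F) (r : int) : F :=
  \sum_(n < B) p ^+ (b * n) * qpochV p n * u (r - (d * n)%N%:Z).

Lemma eq_conv d b u v r : u =1 v -> conv d b u r = conv d b v r.
Proof. by move=> uv; apply: eq_bigr => n _; rewrite uv. Qed.

Lemma convD d b u v r :
  conv d b (fun k => u k + v k) r = conv d b u r + conv d b v r.
Proof. by rewrite -big_split; apply: eq_bigr => n _; rewrite mulrDr. Qed.

Lemma convZ d b c u r : conv d b (fun k => c * u k) r = c * conv d b u r.
Proof. by rewrite mulr_sumr; apply: eq_bigr => n _; rewrite mulrCA. Qed.

Lemma conv_shift d b u c r : conv d b (fun k => u (k - c)) r = conv d b u (r - c).
Proof. by apply: eq_bigr => n _; congr (_ * u _); lia. Qed.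

Lemma conv_eq0 d b u r : (forall k, k <= r -> u k = 0) -> conv d b u r = 0.
Proof. by move=> u0; rewrite /conv big1 // => n _; rewrite u0 ?mulr0 //; lia. Qed.

(** Multiplication by 1 - p^b t^d raises b by one; the hypothesis removes the one term lost by the
    cut. *)
Lemma conv_qpochV d b u r : u (r - (d * B)%N%:Z) = 0 ->
  conv d b u r - conv d b.+1 u r = p ^+ b * conv d b u (r - d%:Z).
Proof.
rewrite /conv -sumrB mulr_sumr; case: B => [|B'] u0; first by rewrite !big_ord0.
rewrite [RHS]big_ord_recr /= (_ : r - d%:Z - _ = r - (d * B'.+1)%N%:Z); last by lia.
rewrite u0 !mulr0 addr0 big_ord_recl /= !muln0 subrr add0r.
apply: eq_bigr => n _; rewrite /bump leq0n add1n.
have -> : (qpoch p p n)^-1 = (1 - p ^+ n.+1) * (qpoch p p n.+1)^-1.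
  rewrite -[LHS]/(qpochV p n) (_ : n%:Z = n.+1%:Z - 1); last by lia.
  by rewrite -qpochV_pred.
rewrite (_ : r - d%:Z - _ = r - (d * n.+1)%N%:Z); last by lia.
by rewrite mulSn mulnS !exprD; ring.
Qed.

Lemma conv_swap (s : int) (u : int -> F) : s < B%:Z -> (forall k, k < 0 -> u k = 0) ->
  \sum_(m < B) u m * qpochV p (s - m%:Z) = \sum_(i < B) qpochV p i * u (s - i%:Z).
Proof.
case: s => [s|s] sB u0; last first.
  rewrite !big1 // => i _; first by rewrite u0 ?mulr0 //; lia.
  by rewrite qpochV_neg ?mulr0 //; lia.
have widen (g : int -> F) : (forall k : nat, (s < k)%N -> g k = 0) ->
    \sum_(i < B) g i = \sum_(i < s.+1) g i.
  move=> g0; rewrite [RHS](big_ord_widen B (fun i : nat => g i)) // [RHS]big_mkcond.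
  by apply: eq_bigr => i _; case: ltnP => // /g0.
rewrite (widen (fun m => u m * qpochV p (s%:Z - m))); last first.
  by move=> k sk; rewrite qpochV_neg ?mulr0 //; lia.
rewrite (widen (fun i => qpochV p i * u (s%:Z - i))); last first.
  by move=> k sk; rewrite u0 ?mulr0 //; lia.
rewrite (reindex_inj rev_ord_inj); apply: eq_bigr => i _; rewrite mulrC.
have -> : (rev_ord i)%:Z = s%:Z - i%:Z by have := ltn_ord i; rewrite /=; lia.
by rewrite opprB addrC subrK.
Qed.

End Convolution.

(** * Powers with triangular exponents *)

Section BinomialPowers.
Variables (F : fieldType) (x : F).
Hypothesis x_neq0 : x != 0.

(* x ^ (k (k - 1) / 2), the exponent being a natural number also for k < 0 *)
Definition binpow (k : int) : F :=
  match k with Posz n => x ^+ 'C(n, 2) | Negz n => x ^+ 'C(n.+2, 2) end.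

Lemma binpow_pred k : binpow k = x ^ (k - 1) * binpow (k - 1).
Proof.
case: k => [[|n]|n].
- rewrite (_ : 0%:Z - 1 = Negz 0) //= (_ : Negz 0 = - 1) // -invr_expz.
  by rewrite binn mulVf ?expfz_neq0.
- rewrite (_ : n.+1%:Z - 1 = n); last by lia.
  by rewrite /= -exprnP binS bin1 exprD mulrC.
rewrite (_ : Negz n - 1 = Negz n.+1); last by lia.
rewrite /= [in RHS]binS bin1 exprD NegzE -invr_expz -exprnP.
by rewrite mulrCA mulVf ?mulr1 // expf_neq0.
Qed.

End BinomialPowers.

(** * Recurrence in M for the double sum *)

Section DoubleSum.
Variables (F : fieldType) (q : F).
Hypothesis q_neq0 : q != 0.
Hypothesis q_nroot : forall k : nat, (0 < k)%N -> q ^+ k != 1.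
Local Notation p := (q ^+ 3).

Let p_neq0 : p != 0. Proof. exact: expf_neq0. Qed.
Let p_nroot k : (0 < k)%N -> p ^+ k != 1.
Proof. by move=> k0; rewrite -exprM q_nroot // muln_gt0. Qed.

Variable B : nat.

(* The k-th coefficient of (-t; q)_oo, times q^(a k). *)
Definition euler_coef (a : nat) (k : int) : F :=
  (q ^ k) ^+ a * (binpow q k * qpochV q k).

(** Coefficient form of (-q^a t; q)_oo = (1 + q^a t) (-q^(a+1) t; q)_oo. *)
Lemma euler_coef_rel a k :
  euler_coef a k - euler_coef a.+1 k = q ^+ a * euler_coef a.+1 (k - 1).
Proof.
rewrite /euler_coef -qpochV_pred // (binpow_pred q_neq0 k) exprSr.
have -> : (q ^ k) ^+ a = q ^+ a * (q ^ (k - 1)) ^+ a.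
  by rewrite -exprMn -{2}(expr1z q) -expfzDr // addrC subrK.
by rewrite exprSr; ring.
Qed.

Lemma euler_coef_neg a k : k < 0 -> euler_coef a k = 0.
Proof. by move=> k0; rewrite /euler_coef qpochV_neg ?mulr0. Qed.

(** Up to the cut at B, the coefficient of t^r in (-q^a t; q)_oo / (p^b t^2; p)_oo; a = b = 0 gives
    g(t), and a = 3, b = 2 gives g(p t). *)
Definition inner_sum (a b : nat) (r : int) : F := conv p B 2 b (euler_coef a) r.

Lemma inner_sum_rel1 a b r :
  inner_sum a b r = inner_sum a.+1 b r + q ^+ a * inner_sum a.+1 b (r - 1).
Proof.
rewrite /inner_sum -conv_shift -convZ -convD; apply: eq_conv => k.
by rewrite -euler_coef_rel addrC subrK.
Qed.

Lemma inner_sum_rel2 a b r : r < (2 * B)%N%:Z ->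
  inner_sum a b.+1 r = inner_sum a b r - p ^+ b * inner_sum a b (r - 2).
Proof.
move=> rB; rewrite /inner_sum -(@conv_qpochV _ _ B p_nroot 2 b); first by ring.
by rewrite euler_coef_neg //; lia.
Qed.

Lemma inner_sum32 r : inner_sum 3 2 r = p ^ r * inner_sum 0 0 r.
Proof.
rewrite /inner_sum mulr_sumr; apply: eq_bigr => n _; rewrite /euler_coef mul0n !expr0.
have -> : p ^ r = (q ^ (r - (2 * n)%N%:Z)) ^+ 3 * p ^+ (2 * n).
  by rewrite -exprzX -[p ^+ (2 * n)]/(p ^ (2 * n)%N%:Z) -expfzDr // subrK.
by ring.
Qed.

Lemma inner_sum_neg a b r : r < 0 -> inner_sum a b r = 0.
Proof. by move=> r0; apply: conv_eq0 => k kr; rewrite euler_coef_neg //; lia. Qed.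

(** Both sides of the functional equation of g equal (-q t; q)_oo / (p^2 t^2; p)_oo. *)
Lemma inner_sum_rel r : r < (2 * B)%N%:Z ->
  inner_sum 0 0 r - inner_sum 0 0 (r - 1) - p * inner_sum 0 0 (r - 2)
    + p * inner_sum 0 0 (r - 3)
  = p ^ r * inner_sum 0 0 r + (q + q ^+ 2) * (p ^ (r - 1) * inner_sum 0 0 (r - 1))
    + p * (p ^ (r - 2) * inner_sum 0 0 (r - 2)).
Proof.
move=> rB; rewrite -!inner_sum32.
have sub (c d e : int) : c + d = e -> r - c - d = r - e by move=> <-; rewrite opprD addrA.
transitivity (inner_sum 1 2 r).
  rewrite !(inner_sum_rel1 0) inner_sum_rel2 // !(inner_sum_rel2 _ 0); try lia.
  rewrite (sub 1 1 2) // (sub 2 1 3) // (sub 3 1 4) // (sub 2 2 4) //.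
  by rewrite !expr0 expr1; ring.
rewrite !(inner_sum_rel1 1) !(inner_sum_rel1 2) (sub 1 1 2) //.
by ring.
Qed.

Definition weighted (a : nat) (r : int) : F := (p ^ r) ^+ a * (binpow p r * inner_sum 0 0 r).

(** Splitting p^C(r,2) as a power of p^(r-i) times p^C(r-i,2) makes the coefficients free of r. *)
Lemma weighted_rel r : r < (2 * B)%N%:Z ->
  weighted 0 r = weighted 1 r + weighted 1 (r - 1) + (q + q ^+ 2) * weighted 2 (r - 1)
   + p ^+ 2 * weighted 2 (r - 2) + p ^+ 2 * weighted 3 (r - 2)
   - p ^+ 4 * weighted 3 (r - 3).
Proof.
move=> rB; have := inner_sum_rel rB; rewrite /weighted.
rewrite (binpow_pred p_neq0 r) (binpow_pred p_neq0 (r - 1)).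
rewrite (_ : r - 1 - 1 = r - 2); last by lia.
rewrite (binpow_pred p_neq0 (r - 2)) (_ : r - 2 - 1 = r - 3); last by lia.
have -> : p ^ r = p ^+ 3 * p ^ (r - 3) by rewrite -[p ^+ 3]/(p ^ 3) -expfzDr // addrC subrK.
have -> : p ^ (r - 1) = p ^+ 2 * p ^ (r - 3).
  by rewrite -[p ^+ 2]/(p ^ 2) -expfzDr //; congr (_ ^ _); lia.
have -> : p ^ (r - 2) = p * p ^ (r - 3).
  by rewrite -[p in RHS](expr1z p) -expfzDr //; congr (_ ^ _); lia.
move: (inner_sum 0 0 r) (inner_sum _ _ (r - 1)) (inner_sum _ _ (r - 2)) (inner_sum _ _ (r - 3)).
move: (p ^ (r - 3)) (binpow p _) => z c g0 g1 g2 g3 E.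
move/eqP: E; rewrite -subr_eq0 => /eqP E; apply: subr0_eq.
(* The multiplier is p^C(r,2), since C(r,2) = C(r-3,2) + 3(r-3) + 3. *)
by rewrite -[RHS](mulr0 (p ^+ 3 * z ^+ 3 * c)) -E; ring.
Qed.

Lemma weighted_neg a r : r < 0 -> weighted a r = 0.
Proof. by move=> r0; rewrite /weighted inner_sum_neg ?mulr0. Qed.

Definition outer_sum (a : nat) (M : int) : F := conv p B 1 0 (weighted a) M.

Lemma outer_sum_neg a M : M < 0 -> outer_sum a M = 0.
Proof. by move=> M0; apply: conv_eq0 => k kM; rewrite weighted_neg //; lia. Qed.

(** Since p^M = p^(M-n) p^n, the product p^M [outer_sum a M] is the convolution of [weighted a.+1]
    with b = 1; [conv_qpochV] relates it to b = 0. *)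
Lemma outer_sumS a M : M < B%:Z ->
  outer_sum a.+1 M = p ^ M * outer_sum a M + outer_sum a.+1 (M - 1).
Proof.
move=> MB; rewrite /outer_sum -[X in _ + X]mul1r -(expr0 p) -(@conv_qpochV _ _ B p_nroot 1 0).
  rewrite (_ : conv p B 1 1 (weighted a.+1) M = p ^ M * conv p B 1 0 (weighted a) M).
    by rewrite addrC subrK.
  rewrite mulr_sumr; apply: eq_bigr => n _; rewrite /weighted !mul1n mul0n expr0.
  have -> : p ^ M = p ^ (M - n%:Z) * p ^+ n.
    by rewrite -[p ^+ n]/(p ^ n%:Z) -expfzDr // subrK.
  by rewrite (exprS (p ^ (M - n%:Z)) a); ring.
by rewrite weighted_neg //; lia.
Qed.

Lemma outer_sum_weighted_rel M : M < (2 * B)%N%:Z ->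
  outer_sum 0 M = outer_sum 1 M + outer_sum 1 (M - 1) + (q + q ^+ 2) * outer_sum 2 (M - 1)
   + p ^+ 2 * outer_sum 2 (M - 2) + p ^+ 2 * outer_sum 3 (M - 2)
   - p ^+ 4 * outer_sum 3 (M - 3).
Proof.
move=> MB; rewrite /outer_sum /conv !mulr_sumr -sumrN -!big_split.
apply: eq_bigr => n _ /=; rewrite weighted_rel; last by lia.
by rewrite !(addrAC M _ (- (1 * n)%N%:Z)); ring.
Qed.

(** Let u be the shift M -> M - 1. By [outer_sumS], 1 - u reduces [outer_sum 1] to [outer_sum 0],
    and (1 - u) (1 - p u) does so for [outer_sum 2]. For [outer_sum 3] a further factor 1 - p^2 u is
    needed, which the last two terms of [outer_sum_weighted_rel] supply. *)
Lemma outer_sum_rec M : M < B%:Z ->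
  (1 - p ^ M) * outer_sum 0 M =
    (1 + p + p ^ (M - 1) - p ^ M + (q + q ^+ 2) * (p ^ (M - 1)) ^+ 2) * outer_sum 0 (M - 1)
    - (p - (p ^ (M - 1)) ^+ 2) * (1 + p ^ (M - 2)) * outer_sum 0 (M - 2).
Proof.
move=> MB.
have sub (c d e : int) : c + d = e -> M - c - d = M - e by move=> <-; rewrite opprD addrA.
have e0 := @outer_sum_weighted_rel M ltac:(lia).
have e1 := @outer_sum_weighted_rel (M - 1) ltac:(lia).
have e2 := @outer_sum_weighted_rel (M - 2) ltac:(lia).
have s0 a := @outer_sumS a M MB.
have s1 a := @outer_sumS a (M - 1) ltac:(lia).
have s2 a := @outer_sumS a (M - 2) ltac:(lia).
have s3 a := @outer_sumS a (M - 3) ltac:(lia).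
have s4 a := @outer_sumS a (M - 4) ltac:(lia).
move: e0 e1 e2 s0 s1 s2 s3 s4.
rewrite (sub 1 1 2) // (sub 1 2 3) // (sub 1 3 4) // (sub 2 1 3) // (sub 2 2 4) // (sub 2 3 5) //.
rewrite (sub 3 1 4) // (sub 4 1 5) //.
have -> : p ^ M = p ^+ 4 * p ^ (M - 4).
  by rewrite -[p ^+ 4]/(p ^ 4) -expfzDr //; congr (_ ^ _); lia.
have -> : p ^ (M - 1) = p ^+ 3 * p ^ (M - 4).
  by rewrite -[p ^+ 3]/(p ^ 3) -expfzDr //; congr (_ ^ _); lia.
have -> : p ^ (M - 2) = p ^+ 2 * p ^ (M - 4).
  by rewrite -[p ^+ 2]/(p ^ 2) -expfzDr //; congr (_ ^ _); lia.
have -> : p ^ (M - 3) = p * p ^ (M - 4).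
  by rewrite -[p in RHS](expr1z p) -expfzDr //; congr (_ ^ _); lia.
move: (p ^ (M - 4)) => z e0 e1 e2 s0 s1 s2 s3 s4.
move/eqP: e0; rewrite -subr_eq0 => /eqP e0.
move/eqP: e1; rewrite -subr_eq0 => /eqP e1.
move/eqP: e2; rewrite -subr_eq0 => /eqP e2.
(* With u the shift M -> M - 1, this applies (1 - u) (1 - p u) to the relation e0. *)
apply: subr0_eq; transitivity (0 - (1 + p) * 0 + p * 0 : F); last by ring.
rewrite -{1}e0 -{1}e1 -e2 !s0 !s1 !s2 !s3 !s4.
by ring.
Qed.

Lemma outer_sum0 : (0 < B)%N -> outer_sum 0 0 = 1.
Proof.
have first_term b d u : (0 < B)%N -> (forall k, k < 0 -> u k = 0) -> (0 < d)%N ->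
    conv p B d b u 0 = u 0.
  rewrite /conv; case: B => // B' _ u0 d0.
  rewrite big_ord_recl !muln0 subr0 expr0 qpochV0 !mul1r big1 ?addr0 // => i _.
  by rewrite u0 ?mulr0 //= /bump; lia.
move=> B0; rewrite /outer_sum first_term //; last by move=> k; exact: weighted_neg.
rewrite /weighted /inner_sum first_term //; last by move=> k; exact: euler_coef_neg.
by rewrite /euler_coef qpochV0 !expr0 !mul1r.
Qed.

Lemma binpowD (m n : nat) :
  binpow q m * binpow p (m%:Z + 2 * n%:Z)
  = q ^ (Qform m n - 2 * m%:Z - 3 * n%:Z).
Proof.
have bin2Z (k : nat) : 2 * ('C(k, 2))%:Z = k%:Z * (k%:Z - 1).
  by elim: k => // k IHk; rewrite binS bin1; lia.
rewrite (_ : m%:Z + 2 * n%:Z = (m + 2 * n)%N) //= -exprM -exprD exprnP.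
congr (_ ^ _); rewrite /Qform.
by have := bin2Z m; have := bin2Z (m + 2 * n)%N; lia.
Qed.

(** The index of the outer convolution is i = M - m - 2n; for fixed n, [conv_swap] with s = M - 2n
    trades it for m. *)
Lemma outer_sum_double_sum (M : nat) : (M < B)%N ->
  outer_sum 0 M = \sum_(m < B) \sum_(n < B)
    q ^ (Qform m n - 2 * m%:Z - 3 * n%:Z) / (qpoch q q m * qpoch p p n)
    * qpochV p (M%:Z - 2 * n%:Z - m%:Z).
Proof.
move=> MB; rewrite exchange_big /=.
transitivity (\sum_(n < B) qpochV p n * \sum_(i < B) qpochV p i *
   (euler_coef 0 (M%:Z - 2 * n%:Z - i%:Z) * binpow p (M%:Z - i%:Z))).
  under eq_bigr do rewrite mulr_sumr.
  rewrite exchange_big; apply: eq_bigr => i _; rewrite /weighted /inner_sum /conv.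
  rewrite mul0n expr0 !mul1r mulrCA !mulr_sumr mul1n.
  apply: eq_bigr => n _.
  by rewrite (_ : M%:Z - i%:Z - (2 * n)%N%:Z = M%:Z - 2 * n%:Z - i%:Z); [ring|lia].
apply: eq_bigr => n _.
have := @conv_swap _ p B (M%:Z - 2 * n%:Z)
  (fun k => euler_coef 0 k * binpow p (k + 2 * n%:Z)).
move=> /(_ ltac:(lia)) swap.
rewrite (eq_bigr (fun i : 'I_B => qpochV p i * (euler_coef 0 (M%:Z - 2 * n%:Z - i%:Z) *
     binpow p (M%:Z - 2 * n%:Z - i%:Z + 2 * n%:Z)))); last first.
  by move=> i _; congr (_ * (_ * binpow _ _)); lia.
rewrite -swap; last by move=> k k0; rewrite euler_coef_neg ?mul0r.
rewrite mulr_sumr; apply: eq_bigr => m _.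
rewrite -binpowD /euler_coef expr0 mul1r invfM.
rewrite -[(qpoch q q m)^-1]/(qpochV q m) -[(qpoch p p n)^-1]/(qpochV p n).
by ring.
Qed.

Definition lhs_poly (M : nat) : F := qpoch p p M * outer_sum 0 M.

(** The last factor is (1 - p^M) L_(M-1), written so that it makes sense, and vanishes, at M = 0. *)
Lemma lhs_polyS (M : nat) : (M.+1 < B)%N ->
  lhs_poly M.+1 = (1 + p + p ^+ M - p ^+ M.+1 + (q + q ^+ 2) * (p ^+ M) ^+ 2) * lhs_poly M
    - (p - (p ^+ M) ^+ 2) * (1 + p ^ (M%:Z - 1))
      * ((1 - p ^+ M) * qpoch p p M.-1 * outer_sum 0 (M%:Z - 1)).
Proof.
move=> MB; rewrite /lhs_poly qpochS -mulrA.
have e1 : M.+1%:Z - 1 = M by lia.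
have e2 : M.+1%:Z - 2 = M%:Z - 1 by lia.
have := @outer_sum_rec M.+1 ltac:(lia); rewrite e1 e2 -[p ^ M.+1]/(p ^+ M.+1) -[p ^ M]/(p ^+ M) => ->.
case: M {MB e1 e2} => [|M].
  by rewrite expr0 (outer_sum_neg 0 (M := 0%:Z - 1)) // /qpoch !big_ord0; ring.
by rewrite qpochS /=; ring.
Qed.

End DoubleSum.

(** * Induction on M matching the two sides *)

Section Comparison.
Variables (F : fieldType) (q : F).
Hypothesis q_neq0 : q != 0.
Hypothesis q_nroot : forall k : nat, (0 < k)%N -> q ^+ k != 1.
Local Notation p := (q ^+ 3).

Variables K B : nat.

(** The recurrence for L_(M+2) contains L_M only through (1 + p^M) L_M, which the first conjunct
    provides. This avoids dividing by 1 + p^M, which is 0 for M = 0 in characteristic 2. *)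
Lemma lhs_rhs_poly M : (M < B)%N -> (M <= K)%N ->
  (1 + p ^+ M) * lhs_poly q B M = rhs_poly q K 1 M + rhs_poly q K 2 M
  /\ ((M.+1 < B)%N -> lhs_poly q B M.+1 =
       (1 + q * p ^+ M) * rhs_poly q K 1 M + (1 + q ^+ 2 * p ^+ M) * rhs_poly q K 2 M).
Proof.
have qpoch0 : qpoch p p 0 = 1 by rewrite /qpoch big_ord0.
elim: M => [|M IHM] MB MK.
  have lhs_poly0 : lhs_poly q B 0 = 1 by rewrite /lhs_poly qpoch0 outer_sum0 ?mulr1.
  have rhs_poly0 k : rhs_poly q K k 0 = 1 by rewrite /rhs_poly moment0 // mulr1.
  split; first by rewrite lhs_poly0 !rhs_poly0 expr0 mulr1.
  move=> B1; rewrite lhs_polyS // lhs_poly0 !rhs_poly0 [outer_sum _ _ _ (_ - _)]outer_sum_neg //.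
  by rewrite !(expr0 p); ring.
have [IH1 IH2] := IHM (ltnW MB) (ltnW MK).
have [r1 r2] := rhs_polyS q_neq0 q_nroot MK.
have pS : p ^+ M.+1 = p * p ^+ M by rewrite exprS.
have lhs_polyM1 := IH2 MB.
split.
  rewrite lhs_polyM1 r1 r2 pS; move: (p ^+ M) (rhs_poly _ _ _ _) (rhs_poly _ _ _ _) => N a b.
  by field.
move=> MB2; rewrite lhs_polyS // lhs_polyM1 r1 r2.
have -> : M.+1%:Z - 1 = M by lia.
rewrite -[_ * (1 + p ^ M) * _]mulrA.
have -> : (1 + p ^ M) * ((1 - p ^+ M.+1) * qpoch p p M.+1.-1 * outer_sum q B 0 M)
   = (1 - p ^+ M.+1) * (rhs_poly q K 1 M + rhs_poly q K 2 M).
  by rewrite -IH1 /lhs_poly -[p ^ M]/(p ^+ M) /=; ring.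
have -> : p ^+ M.+2 = p ^+ 2 * p ^+ M by rewrite -exprD.
rewrite pS; move: (p ^+ M) (rhs_poly _ _ _ _) (rhs_poly _ _ _ _) => N a b.
by field.
Qed.

End Comparison.

Theorem theorem4p5 (F : fieldType) (q : F) (q_neq0 : q != 0)
    (q_not_root_of_unity : forall k : nat, (0 < k)%N -> q ^+ k != 1)
    (M : nat) :
  \sum_(mn \in [set: nat * nat])
     (q ^ (Qform mn.1 mn.2 - 2 * mn.1%:Z - 3 * mn.2%:Z)
        * qpoch (q ^+ 3) (q ^+ 3) M
        / (qpoch q q mn.1 * qpoch (q ^+ 3) (q ^+ 3) mn.2)
        * qpochV (q ^+ 3) (M%:Z - 2 * mn.2%:Z - mn.1%:Z)
        * (1 + q ^+ (3 * M)))
  = \sum_(j \in [set j : int | - M%:Z <= j <= M%:Z])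
     (q ^ (3 * j ^+ 2 - 2 * j) * (1 + q ^ (3 * j))
        * qbinom (q ^+ 3) (2 * M%:Z) (M%:Z + j)).
Proof.
have [sums _] := @lhs_rhs_poly F q q_neq0 q_not_root_of_unity M M.+1 M (ltnSn M) (leqnn M).
have -> : 2 * M%:Z = M.*2%:Z by lia.
transitivity ((1 + (q ^+ 3) ^+ M) * lhs_poly q M.+1 M).
  rewrite (@fsbigE _ _ _ _ _ [seq (m, n) | m <- index_iota 0 M.+1, n <- index_iota 0 M.+1]) //.
  - rewrite /lhs_poly outer_sum_double_sum // !mulr_sumr.
    under eq_bigl do rewrite in_setT.
    rewrite big_allpairs big_mkord; apply: eq_bigr => m _.
    rewrite !mulr_sumr big_mkord; apply: eq_bigr => n _ /=.
    by rewrite (exprM q); ring.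
  - by rewrite allpairs_uniq ?iota_uniq // => -[m n] [m' n'].
  - move=> [m n] _ mn; rewrite qpochV_neg ?mulr0 ?mul0r //=.
    suff : ~~ ((m < M.+1)%N && (n < M.+1)%N) by lia.
    apply: contra mn => /andP[mM nM].
    by apply/allpairsP; exists (m, n); rewrite !mem_index_iota.
(* As q^(3j^2-2j) (1 + q^(3j)) = q^(3j^2-2j) + q^(3j^2+j), the right-hand side is made of mu_(-2) =
   mu_2 and mu_1. *)
rewrite sums /rhs_poly -(momentN q M 2) -mulrDr -big_split mulr_sumr.
rewrite (@zsum_fsbig _ M).
- apply: eq_bigr => i _ /=; move: (_ - _) => j.
  rewrite qbinomE /moment_term expfzDr // (_ : M.*2%:Z - (M%:Z + j) = M%:Z - j); last by lia.
  rewrite expr1z !exprz_exp (_ : - (2 * j) = j * - 2); last by lia.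
  have -> : q ^ (3 * j) = (q ^ (j * - 2))^-1 * q ^ j.
    by rewrite invr_expz -expfzDr //; congr (_ ^ _); lia.
  have : q ^ (j * - 2) != 0 by rewrite expfz_neq0.
  move: (q ^ (j * - 2)) => z z0.
  by field.
- by [].
move=> j jM; rewrite qbinomE.
have [j0|j0] := boolP (M%:Z + j < 0); first by rewrite (qpochV_neg _ j0) mul0r !mulr0.
rewrite [qpochV _ (_ - (_ + _))]qpochV_neg ?mulr0 //.
by apply/negPn; apply/negP => j1; apply: jM; rewrite /=; lia.
Qed.
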